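(* Let $(G,u,v,\alpha,\beta)$ be a Guvab with $\lim_{k\to\infty}W_k=0$ such that the sequence $\{W_{2k}\}_{k\ge0}$ is not eventually constant. Then there exist $0<\lambda_{\mathrm{even}}<1$ and $c>0$ such that $W_{2k}\sim c\cdot\lambda_{\mathrm{even}}^{2k}$ as $k\to\infty$.
   Context: A Guvab is a tuple $(G,u,v,\alpha,\beta)$ where $G$ is a finite, connected, simple graph, $u,v\in V(G)$, and $\alpha,\beta\in[0,1]$ with $\alpha\le\beta$. A random walk on $G$ with starting vertex $w$ and laziness $\gamma$ is the Markov chain $R_0=w$ and, for $i\ge1$, $R_i=R_{i-1}$ with probability $\gamma$ and $R_i=t$ with probability $\frac{1-\gamma}{\deg(R_{i-1})}$ for each neighbor $t$ of $R_{i-1}$. $\mu_k$ is the distribution after $k$ steps of the walk from $u$ with laziness $\alpha$, $\nu_k$ that of the walk from $v$ with laziness $\beta$, and $W_k=W(\mu_k,\nu_k)$ is the Wasserstein ($L^1$ optimal transport) distance with respect to the graph distance. A sequence $\{S_i\}$ is eventually constant if there is $N$ with $S_k=S_N$ for all $k\ge N$; $a_k\sim b_k$ means $a_k/b_k\to1$. *)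

(* Defs.v *)
From HB Require Import structures.
From mathcomp Require Import all_boot all_order all_algebra.
From mathcomp Require Import all_classical all_reals all_analysis.
Set Implicit Arguments. Unset Strict Implicit. Unset Printing Implicit Defensive.
Import Order.TTheory GRing.Theory Num.Theory.
Local Open Scope ring_scope.
Local Open Scope classical_set_scope.

Definition simple_graph (T : finType) (e : rel T) : Prop :=
  symmetric e /\ irreflexive e.
Definition connected_graph (T : finType) (e : rel T) : Prop :=
  forall x y, connect e x y.

Definition deg (T : finType) (e : rel T) (x : T) : nat := #|[pred y | e x y]|.

Definition trans (R : realType) (T : finType) (e : rel T) (g : R) (x y : T) : R :=
  (if x == y then g else 0) + (if e x y then (1 - g) / (deg e x)%:R else 0).

Fixpoint walk (R : realType) (T : finType) (e : rel T) (g : R) (w : T) (k : nat)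
  : T -> R :=
  match k with
  | 0 => fun y => if y == w then 1 else 0
  | k'.+1 => fun y => \sum_(x : T) walk e g w k' x * trans e g x y
  end.

Fixpoint reach (T : finType) (e : rel T) (n : nat) (x y : T) : bool :=
  match n with
  | 0 => x == y
  | n'.+1 => reach e n' x y || [exists z, reach e n' x z && e z y]
  end.

(* Graph distance (for a connected graph it is < #|T|, hence found). *)
Definition gdist (T : finType) (e : rel T) (x y : T) : nat :=
  find (fun n => reach e n x y) (iota 0 #|T|).

Definition coupling (R : realType) (T : finType) (mu nu : T -> R) (pi : T -> T -> R)
  : Prop :=
  (forall x y, 0 <= pi x y) /\
  (forall x, \sum_(y : T) pi x y = mu x) /\
  (forall y, \sum_(x : T) pi x y = nu y).

Definition wasserstein (R : realType) (T : finType) (e : rel T) (mu nu : T -> R) : R :=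
  inf [set c : R | exists pi, coupling mu nu pi /\
         c = \sum_(x : T) \sum_(y : T) pi x y * (gdist e x y)%:R].

Definition Wk (R : realType) (T : finType) (e : rel T) (u v : T) (alpha beta : R)
  (k : nat) : R :=
  wasserstein e (walk e alpha u k) (walk e beta v k).

Definition guvab (R : realType) (T : finType) (e : rel T) (alpha beta : R) : Prop :=
  simple_graph e /\ connected_graph e /\
  0 <= alpha /\ alpha <= beta /\ beta <= 1.

Definition eventually_constant (R : realType) (S : nat -> R) : Prop :=
  exists N, forall k, (N <= k)%N -> S k = S N.

(* Main.v *)
(** For probability measures, the Wasserstein distance depends only on the
    difference: it equals the cheapest cost of a flow whose divergence is
    [mu - nu], because a flow can be rerouted vertex by vertex, at no extra cost
    by the triangle inequality, until it becomes a coupling. This flow cost is a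
    norm on functions of sum zero. The walk is reversible, so the law at time [k]
    is a combination of [l ^ k] for real eigenvalues [l]; at even times only the
    nonnegative numbers [rho = l ^ 2] matter. After collecting equal [rho]'s, the
    largest one with a nonzero coefficient [w] gives [W_{2k} ~ rho ^ k |w|]. *)

Require Import Defs.
From HB Require Import structures.
From mathcomp Require Import all_boot all_order all_algebra.
From mathcomp Require Import all_classical all_reals all_analysis.
From mathcomp Require Import ring lra zify.
From mathcomp Require Import complex spectral.
Import Order.TTheory GRing.Theory Num.Theory.
Local Open Scope ring_scope.
Local Open Scope classical_set_scope.

(** * Flows of prescribed divergence and their least cost *)

Section flow.
Context {R : realType} {T : finType} (d : T -> T -> R).
Hypothesis d_ge0 : forall x y, 0 <= d x y.
Hypothesis d_refl : forall x, d x x = 0.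
Hypothesis d_tri : forall y x z, d x z <= d x y + d y z.

Definition cost (p : T -> T -> R) : R := \sum_x \sum_y p x y * d x y.

(* What remains in excess at x comes from some y and goes on to some z: it is
   sent directly from y to z, proportionally. *)
Lemma reroute (mu nu : T -> R) (x : T) (p : T -> T -> R) :
  (forall y, 0 <= mu y) -> (forall y, 0 <= nu y) ->
  (forall y z, 0 <= p y z) ->
  (forall y, \sum_z p y z - \sum_z p z y = mu y - nu y) ->
  exists q : T -> T -> R, [/\ forall y z, 0 <= q y z,
    \sum_z q x z = mu x, \sum_z q z x = nu x,
    (forall y, y != x -> \sum_z q y z = \sum_z p y z /\
                         \sum_z q z y = \sum_z p z y) & cost q <= cost p].
Proof.
move=> mu0 nu0 p0 divp.
(* The diagonal entry at x costs nothing: it can be reset so that it vanishes or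
   the marginals at x are right. *)
have [r [r0 rE sr rc cr]] : exists r : T -> T -> R, [/\ forall y z, 0 <= r y z,
    r x x = 0 /\ mu x <= \sum_z r x z \/ \sum_z r x z = mu x,
    (forall y, \sum_z r y z - \sum_z r z y = mu y - nu y),
    (forall y, y != x -> \sum_z r y z = \sum_z p y z /\
                         \sum_z r z y = \sum_z p z y) & cost r <= cost p].
  pose t := Num.max 0 (p x x - (\sum_z p x z - mu x)).
  pose f (y z : T) := if (y == x) && (z == x) then t else p y z.
  have frow : \sum_z f x z = \sum_z p x z - p x x + t.
    rewrite (bigD1 x) //= [in RHS](bigD1 x) //= /f !eqxx /=.
    rewrite (eq_bigr (fun z => p x z)); last by move=> z /negbTE ->.
    by rewrite [p x x + _]addrC addrK addrC.
  have fcol : \sum_z f z x = \sum_z p z x - p x x + t.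
    rewrite (bigD1 x) //= [in RHS](bigD1 x) //= /f !eqxx /=.
    rewrite (eq_bigr (fun z => p z x)); last by move=> z /negbTE ->.
    by rewrite [p x x + _]addrC addrK addrC.
  have fne y : y != x -> \sum_z f y z = \sum_z p y z /\
                         \sum_z f z y = \sum_z p z y.
    by move=> /negbTE yx; split; apply: eq_bigr => z _; rewrite /f yx ?andbF.
  have f0 y z : 0 <= f y z.
    by rewrite /f; case: ifP => // _; rewrite le_max lexx.
  exists f; split => //.
  - rewrite frow /f !eqxx /= /t.
    set P := \sum_z p x z; case: (leP 0) => h; first by right; lra.
    by left; split => //; rewrite addr0; lra.
  - move=> y; have [->|yx] := eqVneq y x.
      by rewrite frow fcol -divp; lra.
    by have [-> ->] := fne _ yx.
  - rewrite /cost; apply: ler_sum => y _; apply: ler_sum => z _; rewrite /f.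
    by case: ifP => // /andP[/eqP -> /eqP ->]; rewrite d_refl !mulr0.
case: rE => [[rxx]|rx]; last first.
  by exists r; split => //; have := sr x; lra.
rewrite le_eqVlt => /predU1P[rx|].
  by exists r; split => //; have := sr x; lra.
have := sr x; set A := \sum_z r x z; set B := \sum_z r z x => AB muA.
(* The excess passing through [x]; the divergence condition makes it the same for the outflow [A]
   and the inflow [B]. *)
pose h := A - mu x.
have h0 : 0 < h by rewrite subr_gt0.
have hB : h = B - nu x by rewrite /h; lra.
have A0 : 0 < A by exact: le_lt_trans muA.
have B0 : 0 < B by have := nu0 x; lra.
have An0 := lt0r_neq0 A0; have Bn0 := lt0r_neq0 B0.
pose w (a : R) (y : T) := if y == x then 1 - h / a else 1.
have sumw a (f : T -> R) : \sum_y w a y * f y = \sum_y f y - h / a * f x.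
  rewrite (bigD1 x) //= [in RHS](bigD1 x) //= /w eqxx.
  rewrite (eq_bigr f); last by move=> z /negbTE ->; rewrite mul1r.
  ring.
have wA y : 0 <= w A y.
  rewrite /w; case: ifP => // _.
  by rewrite subr_ge0 ler_pdivrMr // mul1r /h gerBl.
have wB y : 0 <= w B y.
  rewrite /w; case: ifP => // _.
  by rewrite subr_ge0 ler_pdivrMr // mul1r hB gerBl.
(* The flow out of [x] keeps the fraction [1 - h / A], the flow into [x] the fraction [1 - h / B].
   The removed amount [h] goes directly from [y] to [z] with weights [r y x / B] and [r x z / A]. *)
pose q y z := w A y * (w B z * r y z) + h / (A * B) * (r y x * r x z).
have qrow y : \sum_z q y z =
    w A y * (\sum_z r y z - h / B * r y x) + h / B * r y x.
  rewrite big_split /= -!mulr_sumr sumw -/A.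
  by congr (_ + _); field; apply/andP.
have qcol z : \sum_y q y z =
    w B z * (\sum_y r y z - h / A * r x z) + h / A * r x z.
  rewrite big_split /= -mulr_sumr -mulr_suml sumw -/B.
  rewrite -mulr_sumr; congr (_ + _); last by field; apply/andP.
  by ring.
exists q; split.
- by move=> y z; rewrite addr_ge0 ?mulr_ge0 ?invr_ge0 ?mulr_ge0 // ltW.
- by rewrite qrow -/A rxx /w eqxx /h !mulr0 subr0 addr0; field.
- by rewrite qcol -/B rxx /w eqxx hB !mulr0 subr0 addr0; field.
- move=> y yx; have [<- <-] := rc y yx.
  by rewrite qrow qcol /w (negbTE yx); split; ring.
- apply: le_trans cr.
  pose g y := \sum_z r y z * d y z - h / B * (r y x * d y x).
  have -> : cost q = \sum_y w A y * g y +
      h / (A * B) * \sum_y \sum_z r y x * r x z * d y z.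
    rewrite /cost mulr_sumr -big_split; apply: eq_bigr => y _ /=.
    set K := h / (A * B); rewrite /g -sumw !mulr_sumr -big_split.
    apply: eq_bigr => z _ /=.
    by rewrite /q -/B -/K; ring.
  rewrite sumw /g big_split /= sumrN -mulr_sumr -/(cost r) rxx.
  (* The direct flow is priced by its two legs through [x]; after multiplication by [h / (A * B)]
     this is exactly what the scaled row and column save. *)
  have tri : \sum_y \sum_z r y x * r x z * d y z <=
      A * (\sum_y r y x * d y x) + B * (\sum_z r x z * d x z).
    apply: (@le_trans _ _ (\sum_y \sum_z r y x * r x z * (d y x + d x z))).
      apply: ler_sum => y _; apply: ler_sum => z _.
      by rewrite ler_wpM2l ?mulr_ge0.
    rewrite [X in X + _]mulr_sumr [X in _ + X]mulr_suml -big_split /=.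
    apply: ler_sum => y _; rewrite /A !mulr_sumr mulr_suml -big_split.
    by apply: ler_sum => z _ /=; lra.
  have K0 : 0 <= h / (A * B) by rewrite divr_ge0 ?mulr_ge0 ?ltW.
  have := ler_wpM2l K0 tri.
  have -> : forall a b, h / (A * B) * (A * a + B * b) = h / B * a + h / A * b.
    by move=> a b; field; apply/andP.
  rewrite mul0r mulr0 subr0 /cost; lra.
Qed.

(** [reroute] is applied to the vertices one by one; it keeps the marginals at the other vertices,
    so those already corrected stay correct. *)
Lemma coupling_of_flow (mu nu : T -> R) (p : T -> T -> R) :
  (forall y, 0 <= mu y) -> (forall y, 0 <= nu y) ->
  (forall y z, 0 <= p y z) ->
  (forall y, \sum_z p y z - \sum_z p z y = mu y - nu y) ->
  exists2 q, coupling mu nu q & cost q <= cost p.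
Proof.
move=> mu0 nu0 p0 divp.
suff [q [q0 qd qm qc]] : exists q : T -> T -> R, [/\ forall y z, 0 <= q y z,
    forall y, \sum_z q y z - \sum_z q z y = mu y - nu y,
    forall y, y \in enum T -> \sum_z q y z = mu y /\ \sum_z q z y = nu y &
    cost q <= cost p].
  by exists q => //; split=> //; split=> y;
    have [] := qm y (mem_enum T y).
elim: (enum T) => [|x s [q [q0 qd qm qc]]]; first by exists p.
have [r [r0 rx cx rne rc]] := reroute _ _ x _ mu0 nu0 q0 qd.
exists r; split => //.
- move=> y; have [->|yx] := eqVneq y x; first by rewrite rx cx.
  by have [-> ->] := rne y yx.
- move=> y; rewrite inE; have [->|yx] //= := eqVneq y x.
  by have [-> ->] := rne y yx; exact: qm.
- exact: le_trans qc.
Qed.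

(** A transshipment problem: the net outflow is prescribed rather than the two marginals, so flows
    for different [w] can be added and rescaled. *)
Definition flow_costs (w : T -> R) : set R :=
  [set c | exists p : T -> T -> R, [/\ forall x y, 0 <= p x y,
     forall x, \sum_y p x y - \sum_y p y x = w x & c = cost p]].

Definition flow_norm (w : T -> R) : R := inf (flow_costs w).

Lemma cost_ge0 p : (forall x y, 0 <= p x y) -> 0 <= cost p.
Proof.
move=> p0; apply: sumr_ge0 => x _; apply: sumr_ge0 => y _; exact: mulr_ge0.
Qed.

Lemma flow_norm_le (w : T -> R) p : (forall x y, 0 <= p x y) ->
  (forall x, \sum_y p x y - \sum_y p y x = w x) -> flow_norm w <= cost p.
Proof.
move=> p0 pd; apply: ge_inf; last by exists p.
by exists 0 => _ [q [q0 _ ->]]; exact: cost_ge0.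
Qed.

Variable D : R.
Hypothesis d_le : forall x y, d x y <= D.

(** Everything is routed through one hub [b]: the positive part of [w] is sent to [b], and the
    negative part is served from [b]. *)
Lemma small_flow (w : T -> R) : \sum_x w x = 0 ->
  exists p : T -> T -> R, [/\ forall x y, 0 <= p x y,
     forall x, \sum_y p x y - \sum_y p y x = w x & cost p <= D * \sum_x `|w x|].
Proof.
move=> w0; have [b _|T0] := pickP (@predT T); last first.
  exists (fun _ _ => 0); split => // [x|].
    by have := T0 x.
  rewrite /cost !big_pred0 ?mulr0 //; [exact: T0 .. ].
pose P x := Num.max 0 (w x); pose N x := Num.max 0 (- w x).
have PN x : P x - N x = w x.
  by rewrite /P /N; case: (leP 0 (w x)); case: (leP 0 (- w x)); lra.
have aPN x : `|w x| = P x + N x.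
  rewrite /P /N; case: (leP 0 (w x)) => h; case: (leP 0 (- w x)) => h'.
  - by rewrite ger0_norm //; lra.
  - by rewrite ger0_norm //; lra.
  - by rewrite ltr0_norm //; lra.
  - by rewrite ltr0_norm //; lra.
have P0 x : 0 <= P x by rewrite le_max lexx.
have N0 x : 0 <= N x by rewrite le_max lexx.
have sPN : \sum_x P x = \sum_x N x.
  by apply/eqP; rewrite -subr_eq0 -sumrB (eq_bigr w) ?w0.
have sd (a : R) (x : T) : \sum_(y : T) (if y == x then a else 0) = a.
  by rewrite -big_mkcond big_pred1_eq.
exists (fun x y => (if y == b then P x else 0) + (if x == b then N y else 0)).
split.
- by move=> x y; rewrite addr_ge0 //; case: ifP.
- move=> x; rewrite !big_split /= !sd -(PN x).
  by case: (x == b); rewrite ?sPN ?big1_eq; lra.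
- under [in leRHS]eq_bigr do rewrite aPN.
  rewrite big_split /= mulrDr.
  rewrite /cost (eq_bigr (fun x => \sum_y (if y == b then P x else 0) * d x y +
      \sum_y (if x == b then N y else 0) * d x y)); last first.
    by move=> x _; rewrite -big_split; apply: eq_bigr => y _; rewrite mulrDl.
  rewrite big_split /=; apply: lerD.
    rewrite mulr_sumr; apply: ler_sum => x _.
    rewrite (bigD1 b) //= eqxx big1 ?addr0 1?mulrC ?ler_wpM2r //.
    by move=> y /negbTE ->; rewrite mul0r.
  rewrite exchange_big mulr_sumr; apply: ler_sum => x _ /=.
  rewrite (bigD1 b) //= eqxx big1 ?addr0 1?mulrC ?ler_wpM2r //.
  by move=> y /negbTE ->; rewrite mul0r.
Qed.

Lemma flow_normD (w1 w2 : T -> R) : \sum_x w1 x = 0 -> \sum_x w2 x = 0 ->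
  flow_norm (fun x => w1 x + w2 x) <= flow_norm w1 + flow_norm w2.
Proof.
have ne w : \sum_x w x = 0 -> flow_costs w !=set0.
  by move=> /small_flow[p [p0 pd _]]; exists (cost p), p.
have lb w : has_lbound (flow_costs w).
  by exists 0 => _ [q [q0 _ ->]]; exact: cost_ge0.
move=> /ne n1 /ne n2.
rewrite -lerBlDr; apply: lb_le_inf => // _ [p1 [p10 pd1 ->]].
rewrite lerBlDr -lerBlDl; apply: lb_le_inf => // _ [p2 [p20 pd2 ->]].
rewrite lerBlDl.
have -> : cost p1 + cost p2 = cost (fun x y => p1 x y + p2 x y).
  rewrite /cost -big_split; apply: eq_bigr => x _ /=.
  by rewrite -big_split; apply: eq_bigr => y _ /=; rewrite mulrDl.
apply: flow_norm_le => [x y|x]; first by rewrite addr_ge0.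
by rewrite !big_split /= -pd1 -pd2; lra.
Qed.

Lemma flow_norm_bound (w : T -> R) : \sum_x w x = 0 ->
  flow_norm w <= D * \sum_x `|w x|.
Proof.
move=> /small_flow[p [p0 pd pc]]; apply: le_trans pc; exact: flow_norm_le.
Qed.

(** Subadditivity and the crude bound together give Lipschitz continuity, which later lets limits
    pass through the norm. *)
Lemma flow_norm_dist (w1 w2 : T -> R) : \sum_x w1 x = 0 -> \sum_x w2 x = 0 ->
  `|flow_norm w1 - flow_norm w2| <= D * \sum_x `|w1 x - w2 x|.
Proof.
have half (v1 v2 : T -> R) : \sum_x v1 x = 0 -> \sum_x v2 x = 0 ->
    flow_norm v1 - flow_norm v2 <= D * \sum_x `|v1 x - v2 x|.
  move=> s1 s2.
  have s12 : \sum_x (v1 x - v2 x) = 0 by rewrite sumrB s1 s2 subrr.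
  apply: le_trans (flow_norm_bound _ s12); rewrite lerBlDr.
  apply: le_trans (flow_normD _ _ s12 s2); rewrite le_eqVlt; apply/orP; left.
  by apply/eqP; congr flow_norm; apply/funext => x; rewrite subrK.
move=> s1 s2; rewrite ler_norml half // andbT lerNl opprB.
by under eq_bigr do rewrite distrC; exact: half.
Qed.

Lemma flow_normZ (t : R) (w : T -> R) : 0 < t -> \sum_x w x = 0 ->
  flow_norm (fun x => t * w x) = t * flow_norm w.
Proof.
have half (a : R) (v : T -> R) : 0 < a -> \sum_x v x = 0 ->
    flow_norm (fun x => a * v x) <= a * flow_norm v.
  move=> a0 s; rewrite -ler_pdivrMl //; apply: lb_le_inf.
    by have [p [p0 pd _]] := small_flow _ s; exists (cost p), p.
  move=> _ [p [p0 pd ->]]; rewrite ler_pdivrMl //.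
  have -> : a * cost p = cost (fun x y => a * p x y).
    rewrite /cost mulr_sumr; apply: eq_bigr => x _; rewrite mulr_sumr.
    by apply: eq_bigr => y _; rewrite mulrA.
  apply: flow_norm_le => [x y|x]; first by rewrite mulr_ge0 // ltW.
  by rewrite -!mulr_sumr -mulrBr pd.
(* The reverse inequality is [half] for the factor [t^-1] applied to [t * w]. *)
move=> t0 s; apply/eqP; rewrite eq_le half //= -ler_pdivlMl //.
have st : \sum_x t * w x = 0 by rewrite -mulr_sumr s mulr0.
have := half t^-1 _ _ st; rewrite invr_gt0 => /(_ t0).
rewrite (_ : (fun _ => _) = w) //; apply/funext => x.
by rewrite mulKf ?gt_eqF.
Qed.

(** The diagonal entry cancels in the divergence, and every other unit leaving or entering [x] costs
    at least 1. This will make the norm of a nonzero limit positive. *)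
Lemma flow_norm_ge (w : T -> R) (x : T) : (forall y z, y != z -> 1 <= d y z) ->
  \sum_x w x = 0 -> `|w x| <= flow_norm w.
Proof.
move=> d1 s; apply: lb_le_inf.
  by have [p [p0 pd _]] := small_flow _ s; exists (cost p), p.
move=> _ [p [p0 pd ->]].
have offdiag y z : y != z -> p y z <= p y z * d y z.
  by move=> /d1; apply: ler_peMr.
have costE : forall y, \sum_z p y z * d y z <= cost p.
  move=> y; rewrite /cost [leRHS](bigD1 y) //= lerDl.
  apply: sumr_ge0 => z _.
  by apply: sumr_ge0 => z' _; rewrite mulr_ge0.
have costE' : forall y, \sum_z p z y * d z y <= cost p.
  move=> y; rewrite /cost exchange_big [leRHS](bigD1 y) //= lerDl.
  apply: sumr_ge0 => z _.
  by apply: sumr_ge0 => z' _; rewrite mulr_ge0.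
have row_le : \sum_z p x z - p x x <= cost p.
  apply: le_trans (costE x); rewrite (bigD1 x) //= [leRHS](bigD1 x) //=.
  rewrite d_refl mulr0 add0r [p x x + _]addrC addrK.
  by apply: ler_sum => z zx; rewrite offdiag // eq_sym.
have col_le : \sum_z p z x - p x x <= cost p.
  apply: le_trans (costE' x); rewrite (bigD1 x) //= [leRHS](bigD1 x) //=.
  rewrite d_refl mulr0 add0r [p x x + _]addrC addrK.
  by apply: ler_sum => z zx; rewrite offdiag.
have row_ge : p x x <= \sum_z p x z by rewrite (bigD1 x) //= lerDl sumr_ge0.
have col_ge : p x x <= \sum_z p z x by rewrite (bigD1 x) //= lerDl sumr_ge0.
by rewrite -pd ler_norml; apply/andP; split; lra.
Qed.

End flow.

(** * Spectral expansion of the walk *)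

(** The spectral theorem is applied to [S] seen as a complex hermitian matrix. The eigenvalues are
    real, so taking real parts of the coefficients brings the identity back to [R]. *)
Lemma symmetric_pow_exp_sum (R : rcfType) n (S : 'M[R]_n) : S^T = S ->
  exists (l : 'I_n -> R) (c : 'I_n -> 'M[R]_n),
    forall k, iter k (mulmxr S) 1%:M = \sum_i l i ^+ k *: c i.
Proof.
move=> symS; pose f := real_complex R.
pose A := map_mx f S.
have hA : A \is hermsymmx.
  apply: realsym_hermsym.
    apply/is_hermitianmxP; rewrite expr0 scale1r; apply/matrixP => i j.
    by rewrite !mxE /= -[in LHS]symS mxE.
  apply/mxOverP => i j; rewrite mxE; apply/Creal_ImP; by rewrite -complexIm.
have /mxOverP real_l := hermitian_spectral_diag_real hA.
have /orthomx_spectralP := hermitian_normalmx hA.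
have unitP := spectral_unit A.
set P := spectralmx A in unitP *; set sp := spectral_diag A in real_l * => AE.
have powA k : map_mx f (iter k (mulmxr S) 1%:M) =
    invmx P *m diag_mx (map_mx (fun z => z ^+ k) sp) *m P.
  elim: k => [|k IH] /=.
    rewrite (_ : map_mx _ sp = const_mx 1); last first.
      by apply/matrixP => i j; rewrite !mxE expr0.
    by rewrite diag_const_mx mulmx1 mulVmx // map_mx1.
  rewrite map_mxM IH -/A AE -!mulmxA mulKVmx //; congr (_ *m _).
  rewrite mulmxA mulmx_diag; congr (diag_mx _ *m _).
  by apply/matrixP => i j; rewrite !ord1 !mxE exprSr.
exists (fun i => complex.Re (sp 0 i)), (fun i =>
  \matrix_(a, b) complex.Re (invmx P a i * P i b)).
move=> k; apply/matrixP => a b.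
have := powA k => /matrixP/(_ a b).
rewrite mxE => /(congr1 (@complex.Re R)) /= ->.
rewrite summxE mxE raddf_sum; apply: eq_bigr => i _.
rewrite mul_mx_diag !mxE.
rewrite -[sp 0 i]RRe_real // -rmorphXn /= mulrAC mulrC.
by case: (_ * P i b) => x y /=; rewrite mul0r subr0.
Qed.

Lemma walk_exp_sum (R : realType) (T : finType) (e : rel T) (g : R) (u : T) :
  symmetric e -> (forall x, 0 < deg e x)%N ->
  exists (l : 'I_#|T| -> R) (c : 'I_#|T| -> T -> R),
    forall k y, walk e g u k y = \sum_i l i ^+ k * c i y.
Proof.
move=> esym dpos.
pose s (x : T) : R := Num.sqrt (deg e x)%:R.
have s0 x : s x != 0 by rewrite sqrtr_eq0 -ltNge ltr0n.
have ss x : s x * s x = (deg e x)%:R by rewrite -expr2 sqr_sqrtr.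
(* trans is self-adjoint for the weights deg, so conjugating by their square
   roots makes it symmetric. *)
pose S : 'M[R]_#|T| := \matrix_(i, j) (s (enum_val i) *
  trans e g (enum_val i) (enum_val j) / s (enum_val j)).
have symS : S^T = S.
  apply/matrixP => i j; rewrite !mxE /trans.
  rewrite [enum_val j == _]eq_sym [e (enum_val j) _]esym -!ss.
  have [->|_] := eqVneq; first by [].
  by case: ifP => _; field; rewrite ?s0.
have [l [c lc]] := symmetric_pow_exp_sum _ _ _ symS.
exists l, (fun i y => c i (enum_rank u) (enum_rank y) * s y / s u) => k y.
(* In a power of the conjugated matrix the inner factors [s] cancel; only those at the endpoints [u]
   and [y] survive. *)
suff -> : walk e g u k y =
    iter k (mulmxr S) 1%:M (enum_rank u) (enum_rank y) * s y / s u.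
  rewrite lc summxE !mulr_suml; apply: eq_bigr => i _.
  by rewrite !mxE !mulrA.
elim: k y => [|k IH] y /=.
  rewrite mxE (inj_eq enum_rank_inj) eq_sym; case: eqVneq => [->|_] /=.
    by rewrite mul1r divff.
  by rewrite !mul0r.
rewrite mxE !mulr_suml (reindex _ (onW_bij _ (@enum_val_bij T))) /=.
apply: eq_bigr => i _; rewrite IH !mxE enum_valK enum_rankK.
by field; rewrite ?s0.
Qed.

(** * Asymptotics of exponential sums *)

(** Each class of equal bases gets one representative, which carries the sum of the coefficients of
    its class; all other coefficients become 0. *)
Lemma regroup_exp_sum (R : realType) (I : finType) (T : Type) (r : I -> R)
    (c : I -> T -> R) :
  exists w : I -> T -> R,
    (forall k x, \sum_i r i ^+ k * c i x = \sum_i r i ^+ k * w i x) /\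
    (forall i j x y, w i x != 0 -> w j y != 0 -> r i = r j -> i = j).
Proof.
(* Since [i] itself passes the test, the default is never returned, and the choice depends only on
   the value [r i]. *)
pose p i := odflt i [pick j | r j == r i].
have rp i : r (p i) = r i.
  by rewrite /p; case: pickP => [j /eqP //|/(_ i)]; rewrite eqxx.
have pr i j : r i = r j -> p i = p j.
  by rewrite /p => ->; case: pickP => // /(_ j); rewrite eqxx.
exists (fun j x => \sum_(i | p i == j) c i x); split.
  move=> k x; rewrite (partition_big p predT) //=; apply: eq_bigr => j _.
  by rewrite mulr_sumr; apply: eq_bigr => i /eqP <-; rewrite rp.
have wp j x : \sum_(i | p i == j) c i x != 0 -> exists i, p i = j.
  have [i /eqP ij _|no] := pickP (fun i => p i == j); first by exists i.
  by rewrite big_pred0 ?eqxx.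
by move=> i j x y /wp[i' <-] /wp[j' <-]; rewrite !rp; exact: pr.
Qed.

Lemma cvg_sum_fin (R : realType) (I : finType) (f : I -> nat -> R)
    (l : I -> R) :
  (forall i, f i @ \oo --> (l i : R^o)) ->
  (fun k => \sum_i f i k) @ \oo --> (\sum_i l i : R^o).
Proof.
move=> fl; have addc : continuous (fun z : R^o * R^o => z.1 + z.2).
  by move=> z; exact: add_continuous.
exact: (@cvg_big R^o I +%R 0 xpredT addc nat \oo (index_enum I) f l _
  (fun i _ => fl i)).
Qed.

(** Dividing by the power of the largest base with a nonzero coefficient kills all other terms. The
    first alternative excludes [k = 0], where [0 ^+ 0 = 1] lets a zero base contribute. *)
Lemma dominant_exp_sum (R : realType) (I T : finType) (r : I -> R)
    (c : I -> T -> R) : (forall i, 0 <= r i) ->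
  (forall k x, (0 < k)%N -> \sum_i r i ^+ k * c i x = 0) \/
  exists (rho : R) (w : T -> R), [/\ 0 < rho, exists x, w x != 0 &
    forall x, (fun k => (\sum_i r i ^+ k * c i x) / rho ^+ k) @ \oo -->
      (w x : R^o)].
Proof.
move=> r0; have [w [cw inj_r]] := regroup_exp_sum _ _ _ r c.
pose good i := (r i != 0) && [exists x, w i x != 0].
have [i0 good0|nogood] := pickP good; last first.
  left=> k x k0; rewrite cw big1 // => i _.
  have := nogood i; rewrite /good; case: eqVneq => [->|_] /=.
    by rewrite expr0n gtn_eqF // mul0r.
  by move=> /negbT/existsPn/(_ x)/negPn/eqP ->; rewrite mulr0.
right; have [j /andP[rj /existsP[z wz]] jmax] := arg_maxP r good0.
exists (r j), (w j); split; [by rewrite lt0r rj r0 | by exists z |] => x.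
have -> : w j x = \sum_i (if i == j then w i x else 0).
  by rewrite -big_mkcond big_pred1_eq.
have -> : (fun k => (\sum_i r i ^+ k * c i x) / r j ^+ k) =
    (fun k => \sum_i ((r i / r j) ^+ k * w i x)).
  apply/funext => k; rewrite cw mulr_suml; apply: eq_bigr => i _.
  by rewrite expr_div_n mulrAC.
apply: (@cvg_sum_fin _ _ (fun i k => (r i / r j) ^+ k * w i x)) => i.
have [->|ij] := eqVneq i j.
  rewrite divff //; under eq_fun do rewrite expr1n mul1r.
  exact: (@cvg_cst R^o).
have [->|wi] := eqVneq (w i x) 0.
  under eq_fun do rewrite mulr0.
  exact: (@cvg_cst R^o).
suff lt1 : `|r i / r j| < 1.
  have := cvgM (cvg_expr lt1) (@cvg_cst R^o (w i x) nat \oo _).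
  by rewrite mul0r; exact.
rewrite ger0_norm ?divr_ge0 // ltr_pdivrMr ?mul1r ?lt0r ?rj ?r0 //.
(* Regrouping rules out equality, as both coefficients are nonzero. A zero base was no candidate for
   the maximum, so it is compared separately. *)
rewrite lt_neqAle; apply/andP; split.
  by apply: contra ij => /eqP/(inj_r _ _ _ _ wi wz) ->.
have [->|ri] := eqVneq (r i) 0; first exact: r0.
by apply: jmax; rewrite /good ri; apply/existsP; exists x.
Qed.

(** * Bounds and triangle inequality for the graph distance *)

Section gdist.
Context (T : finType) (e : rel T).

Lemma gdist_refl x : gdist e x x = 0%N.
Proof.
rewrite /gdist; have : (0 < #|T|)%N by apply/card_gt0P; exists x.
by case: #|T| => //= n _; rewrite eqxx.
Qed.

Lemma gdist_gt0 x y : x != y -> (0 < gdist e x y)%N.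
Proof.
move=> /negbTE xy; rewrite /gdist.
have : (0 < #|T|)%N by apply/card_gt0P; exists x.
by case: #|T| => //= n _; rewrite xy.
Qed.

(** A failing [find] returns the length of the list, here [#|T|]. *)
Lemma gdist_le x y : (gdist e x y <= #|T|)%N.
Proof. by rewrite -[leqRHS](size_iota 0) find_size. Qed.

Lemma reach_gdist x y : (gdist e x y < #|T|)%N -> reach e (gdist e x y) x y.
Proof.
rewrite -[ltnRHS](size_iota 0) -has_find => h.
have := nth_find 0%N h; rewrite nth_iota ?add0n //.
by rewrite -[ltnRHS](size_iota 0) -has_find.
Qed.

Lemma gdist_min n x y : (n < #|T|)%N -> reach e n x y -> (gdist e x y <= n)%N.
Proof.
move=> nT xy; rewrite leqNgt; apply/negP => /(before_find 0%N).
by rewrite nth_iota // add0n xy.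
Qed.

Lemma reach_trans m n y x z :
  reach e m x y -> reach e n y z -> reach e (m + n) x z.
Proof.
move=> xy; elim: n z => [|n IH] z /=; first by rewrite addn0 => /eqP <-.
rewrite addnS /= => /orP[/IH -> //|/existsP[t /andP[/IH h tz]]].
by apply/orP; right; apply/existsP; exists t; rewrite h tz.
Qed.

Lemma gdist_triangle y x z : (gdist e x z <= gdist e x y + gdist e y z)%N.
Proof.
(* If the sum reaches [#|T|], the universal bound suffices; otherwise both distances lie below the
   default value and are witnessed by [reach]. *)
have [big|small] := leqP #|T| (gdist e x y + gdist e y z).
  exact: leq_trans (gdist_le x z) big.
apply: gdist_min => //; apply: (reach_trans _ _ y).
  by apply: reach_gdist; apply: leq_ltn_trans small; rewrite leq_addr.
by apply: reach_gdist; apply: leq_ltn_trans small; rewrite leq_addl.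
Qed.

End gdist.

(** * The Wasserstein distance as a flow norm *)

Section gdist_transport.
Context {R : realType} {T : finType} (e : rel T).

Let d (x y : T) : R := (gdist e x y)%:R.

Let d_ge0 x y : 0 <= d x y. Proof. exact: ler0n. Qed.
Let d_refl x : d x x = 0. Proof. by rewrite /d gdist_refl. Qed.
Let d_tri y x z : d x z <= d x y + d y z.
Proof. by rewrite /d -natrD ler_nat gdist_triangle. Qed.
Let d_le x y : d x y <= #|T|%:R. Proof. by rewrite ler_nat gdist_le. Qed.
Let d_ge1 x y : x != y -> 1 <= d x y.
Proof. by move=> xy; rewrite /d ler1n gdist_gt0. Qed.

(** Every coupling is a flow of divergence [mu - nu], which gives one inequality; [coupling_of_flow]
    gives the other. *)
Lemma wasserstein_flow_norm (mu nu : T -> R) :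
  (forall x, 0 <= mu x) -> (forall x, 0 <= nu x) ->
  \sum_x mu x = \sum_x nu x ->
  wasserstein e mu nu = flow_norm d (fun x => mu x - nu x).
Proof.
move=> mu0 nu0 munu.
have s0 : \sum_x (mu x - nu x) = 0 by rewrite sumrB munu subrr.
have [p [p0 pd _]] := small_flow d _ d_le _ s0.
have lbW : has_lbound [set c : R | exists pi, coupling mu nu pi /\
         c = \sum_(x : T) \sum_(y : T) pi x y * (gdist e x y)%:R].
  by exists 0 => _ [q [[q0 _] ->]]; exact: (cost_ge0 d d_ge0).
apply/eqP; rewrite eq_le; apply/andP; split.
  apply: lb_le_inf; first by exists (cost d p), p.
  move=> _ [q [q0 qd ->]].
  have [q' cq' /(le_trans _)] :=
    coupling_of_flow d d_refl d_tri _ _ _ mu0 nu0 q0 qd.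
  by apply; apply: ge_inf => //; exists q'.
have [q cq _] := coupling_of_flow d d_refl d_tri _ _ _ mu0 nu0 p0 pd.
apply: lb_le_inf; first by exists (cost d q), q.
move=> _ [q' [[q0 [qr qc]] ->]].
by apply: (flow_norm_le d d_ge0) => // x; rewrite qr qc.
Qed.

Lemma flow_norm_cvg (f : nat -> T -> R) (w : T -> R) :
  (forall k, \sum_x f k x = 0) -> \sum_x w x = 0 ->
  (forall x, (fun k => f k x) @ \oo --> (w x : R^o)) ->
  (fun k => flow_norm d (f k)) @ \oo --> (flow_norm d w : R^o).
Proof.
move=> f0 w0 fw.
have lim0 : (fun k => #|T|%:R * \sum_x `|f k x - w x|) @ \oo --> (0 : R^o).
  have dist0 x : (fun k => `|f k x - w x|) @ \oo --> (0 : R^o).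
    have := @cvg_norm R R^o _ _ _ _ _
      (cvgB (fw x) (@cvg_cst R^o (w x) nat \oo _)).
    by rewrite subrr normr0; exact.
  have := cvg_sum_fin _ _ (fun x k => `|f k x - w x|) (fun=> 0) dist0.
  rewrite big1_eq => /(cvgM (@cvg_cst R^o #|T|%:R nat \oo _)).
  by rewrite mulr0; exact.
apply/cvgrPdist_lt => eps eps0.
move/cvgrPdist_lt/(_ _ eps0) : lim0; apply: filterS => k.
rewrite sub0r normrN distrC; apply: le_lt_trans.
by apply: le_trans (ler_norm _); apply: (flow_norm_dist d d_ge0).
Qed.

Lemma flow_norm_gdist_ge (w : T -> R) x : \sum_x w x = 0 ->
  `|w x| <= flow_norm d w.
Proof. exact: (flow_norm_ge d d_ge0 d_refl _ d_le). Qed.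

Lemma flow_norm_gdistZ (t : R) (w : T -> R) : 0 < t -> \sum_x w x = 0 ->
  flow_norm d (fun x => t * w x) = t * flow_norm d w.
Proof. exact: (flow_normZ d d_ge0 _ d_le). Qed.

(** This serves the one-vertex graph, where the degree is 0 and a walk of laziness below 1 loses
    mass. A coupling may then fail to exist, and the infimum of the empty set is 0 by convention. *)
Lemma wasserstein_trivial (mu nu : T -> R) : (forall x y : T, x = y) ->
  wasserstein e mu nu = 0.
Proof.
move=> T1; rewrite /wasserstein; set A := [set c | _].
have A0 c : A c -> c = 0.
  move=> [p [_ ->]]; apply: big1 => x _; apply: big1 => y _.
  by rewrite (T1 x y) gdist_refl mulr0.
have [[c Ac]|nA] := pselect (A !=set0).
  suff -> : A = [set 0] by rewrite inf1.
  by apply/seteqP; split=> [c' /A0|c' ->] //; rewrite -(A0 _ Ac).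
suff -> : A = set0 by rewrite inf0.
by apply/seteqP; split => // c Ac; apply: nA; exists c.
Qed.

End gdist_transport.

(** * The law of the walk as a probability distribution *)

Section walk_probability.
Context {R : realType} {T : finType} (e : rel T) (g : R) (w : T).
Hypothesis deg_gt0 : forall x, (0 < deg e x)%N.

Lemma walk_ge0 k x : 0 <= g <= 1 -> 0 <= walk e g w k x.
Proof.
move=> /andP[g0 g1]; elim: k x => [|k IH] x /=; first by case: ifP.
apply: sumr_ge0 => y _; rewrite mulr_ge0 //; apply: addr_ge0.
  by case: ifP.
by case: ifP => // _; rewrite divr_ge0 ?subr_ge0.
Qed.

Lemma walk_sum1 k : \sum_x walk e g w k x = 1.
Proof.
elim: k => [|k IH] /=; first by rewrite -big_mkcond big_pred1_eq.
rewrite exchange_big /= -[RHS]IH; apply: eq_bigr => x _.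
rewrite -mulr_sumr big_split /= -!big_mkcond /=.
rewrite (big_pred1 x) => [|y]; last by rewrite /= eq_sym.
rewrite sumr_const -[X in _ + X]mulr_natr -/(deg e x).
rewrite divfK ?pnatr_eq0 -?lt0n //; ring.
Qed.

End walk_probability.

(** One of [y] and [z] differs from [x], and a path from [x] to it starts with an edge. *)
Lemma connected_deg_gt0 (T : finType) (e : rel T) (x y z : T) :
  connected_graph e -> y != z -> (0 < deg e x)%N.
Proof.
move=> conn yz; apply/card_gt0P.
have [t xt] : exists t, x != t.
  by have [->|xy] := eqVneq x y; [exists z | exists y].
have /connectP[[|a p] /= ep et] := conn x t.
  by rewrite et eqxx in xt.
by exists a; have /andP[] := ep.
Qed.

(** * Asymptotics at even times *)

Lemma cvg_double : (fun k => 2 * k)%N @ \oo --> \oo.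
Proof. by move=> A [N _ NA]; exists N => // k /= Nk; apply: NA => /=; lia. Qed.

Theorem theorem6p3 (R : realType) (T : finType) (e : rel T) (u v : T)
  (alpha beta : R) :
  guvab e alpha beta ->
  ((fun k : nat => Wk e u v alpha beta k) @ \oo --> (0 : R^o)) ->
  ~ eventually_constant (fun k => Wk e u v alpha beta (2 * k)%N) ->
  exists (lam c : R), 0 < lam < 1 /\ 0 < c /\
    ((fun k : nat => Wk e u v alpha beta (2 * k)%N / (c * lam ^+ (2 * k)))
       @ \oo --> (1 : R^o)).
Proof.
move=> [[e_sym _] [conn [a0 [ab b1]]]] W0 nconst.
(* A single vertex has degree 0 and is treated apart: there the distance vanishes at all times,
   against [nconst]. *)
have [[y [z yz]]|T1] := pselect (exists y z : T, y != z); last first.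
  have eqT (x y : T) : x = y.
    by apply/eqP; apply: contra_notT T1 => xy; exists x, y.
  by case: nconst; exists 0%N => k _; rewrite /Wk !wasserstein_trivial.
have deg0 x : (0 < deg e x)%N by exact: connected_deg_gt0 conn yz.
pose d (x y : T) : R := (gdist e x y)%:R.
pose D k x : R := walk e alpha u (2 * k) x - walk e beta v (2 * k) x.
have D0 k : \sum_x D k x = 0 by rewrite sumrB !walk_sum1 // subrr.
have WE k : Wk e u v alpha beta (2 * k) = flow_norm d (D k).
  rewrite /Wk wasserstein_flow_norm ?walk_sum1 // => x; apply: walk_ge0 => //;
    by apply/andP; split; lra.
have [l1 [c1 E1]] := walk_exp_sum _ _ e alpha u e_sym deg0.
have [l2 [c2 E2]] := walk_exp_sum _ _ e beta v e_sym deg0.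
(* The two spectra are merged over a sum type; even times replace eigenvalues by their squares, so
   all bases are nonnegative. *)
pose r (i : 'I_#|T| + 'I_#|T|) : R :=
  match i with inl i => l1 i ^+ 2 | inr i => l2 i ^+ 2 end.
pose c (i : 'I_#|T| + 'I_#|T|) (x : T) : R :=
  match i with inl i => c1 i x | inr i => - c2 i x end.
have DE k x : D k x = \sum_i r i ^+ k * c i x.
  rewrite /D E1 E2 big_sumType /= -sumrN; congr (_ + _); apply: eq_bigr => i _.
    by rewrite exprM.
  by rewrite mulrN exprM.
have r0 i : 0 <= r i by case: i => i; exact: sqr_ge0.
have [Dz|[rho [w [rho0 [x wx] Dw]]]] := dominant_exp_sum _ _ _ r c r0.
  (* Constancy starts at 1, since an eigenvalue 0 may still contribute at time 0. *)
  case: nconst; exists 1%N => k k0; rewrite !WE; congr flow_norm.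
  by apply/funext => x; rewrite !DE !Dz.
have w0 : \sum_x w x = 0.
  apply/esym; have := cvg_sum_fin _ _ _ _ Dw; apply: norm_cvg_unique.
  rewrite (_ : (fun _ => _) = fun=> 0); first exact: (@cvg_cst R^o).
  apply/funext => k; rewrite -mulr_suml -[X in X / _](_ : \sum_x D k x = _).
    by rewrite D0 mul0r.
  by apply: eq_bigr => t _; rewrite DE.
have N0 : 0 < flow_norm d w.
  by apply: lt_le_trans (flow_norm_gdist_ge e _ x w0); rewrite normr_gt0.
have rhok k : 0 < rho ^+ k by rewrite exprn_gt0.
(* Homogeneity moves the division by [rho ^+ k] inside the norm, where vertexwise convergence is
   enough. *)
have lim : (fun k => Wk e u v alpha beta (2 * k) / rho ^+ k) @ \oo -->
    (flow_norm d w : R^o).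
  have -> : (fun k => Wk e u v alpha beta (2 * k) / rho ^+ k) =
      (fun k => flow_norm d (fun x => (rho ^+ k)^-1 * D k x)).
    apply/funext => k; rewrite WE flow_norm_gdistZ ?invr_gt0 //.
    by rewrite mulrC.
  apply: flow_norm_cvg => // [k|t]; first by rewrite -mulr_sumr D0 mulr0.
  rewrite (_ : (fun k => _) = fun k => (\sum_i r i ^+ k * c i t) / rho ^+ k).
    exact: Dw.
  by apply/funext => k; rewrite DE mulrC.
(* If [1 <= rho], the quotient by [rho ^+ k] is at most the distance itself, which tends to 0,
   against the positive limit. *)
have rho1 : rho < 1.
  rewrite ltNge; apply/negP => rho1.
  have W20 : (fun k => Wk e u v alpha beta (2 * k)) @ \oo --> (0 : R^o).
    exact: (cvg_comp _ _ cvg_double W0).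
  suff : flow_norm d w <= 0 by rewrite leNgt N0.
  apply: (ler_cvg_to lim W20); apply: nearW => k.
  rewrite ler_pdivrMr // ler_peMr ?exprn_ege1 // WE.
  exact: le_trans (normr_ge0 _) (flow_norm_gdist_ge e _ x (D0 k)).
(* The square root turns [lam ^+ (2 * k)] into [rho ^+ k]; the constant is the limit in [lim]. *)
exists (Num.sqrt rho), (flow_norm d w); split; last split => //.
  by rewrite sqrtr_gt0 rho0 /= -[ltRHS]sqrtr1 ltr_sqrt.
have -> : (fun k => Wk e u v alpha beta (2 * k) /
      (flow_norm d w * Num.sqrt rho ^+ (2 * k))) =
    (fun k => Wk e u v alpha beta (2 * k) / rho ^+ k * (flow_norm d w)^-1).
  apply/funext => k; rewrite exprM sqr_sqrtr ?ltW // invfM; ring.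
have := cvgM lim (@cvg_cst R^o (flow_norm d w)^-1 nat \oo _).
by rewrite divff ?gt_eqF //; exact.
Qed.
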